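(* Let $\mathbb{H}\in\mathbb{R}_+^{n_R\times n_T}$ have rank $r=n_T-1\ge 1$, let $\boldsymbol{\alpha}\in[0,1]^{n_T}$ and $\sigma>0$. Then the capacity $\mathsf{C}_{\mathsf E}(\widetilde{\mathbb{H}},\boldsymbol{\alpha},\sigma)$ of the multiple-input multiple-output optical intensity channel under equal-cost constraints satisfies $$\mathsf{C}_{\mathsf E}(\widetilde{\mathbb{H}},\boldsymbol{\alpha},\sigma)=\sup_{\mathscr{P}_{\mathbf{S}}} I(\mathbf{S};\mathbf{S}+\mathbf{Z}),$$ where $\mathbf{Z}\sim\mathcal{N}(\mathbf{0}_r,\sigma^2\mathbb{I}_r)$ is independent of $\mathbf{S}$ and the supremum is over all probability laws $\mathscr{P}_{\mathbf{S}}$ of a random vector $\mathbf{S}$ in $\mathbb{R}^{r}$ with $\operatorname{supp}\mathbf{S}\subseteq\mathcal{R}(\widetilde{\mathbb{H}})$ and $$\mathbb{E}[\mathbf{S}]=\widetilde{\mathbb{H}}\boldsymbol{\alpha},\qquad \mathbb{E}[f_{\min}(\mathbf{S})]\le \mathbf{v}_{n_T}^{\mathsf T}\boldsymbol{\alpha},\qquad \mathbb{E}\big[f_{\min}(\widetilde{\mathbb{H}}\mathbf{1}-\mathbf{S})\big]\le \mathbf{v}_{n_T}^{\mathsf T}(\mathbf{1}-\boldsymbol{\alpha}),$$ where $$f_{\min}(\mathbf{s})=\max_{i:\,v_{n_T,i}\ne 0}\left\{\frac{1-\operatorname{sign}(v_{n_T,i})}{2v_{n_T,i}}-\sum_{j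=1}^{n_T-1}\frac{v_{j,i}s_j}{v_{n_T,i}\sigma_j}\right\}.$$
   Context: Let $\sigma_1\ge\cdots\ge\sigma_r>0$ be the nonzero singular values of $\mathbb{H}$ and let $\mathbb{V}=[\mathbf{v}_1,\dots,\mathbf{v}_{n_T}]$ be an orthogonal $n_T\times n_T$ matrix whose column $\mathbf{v}_i$, $i\le r$, is an eigenvector of $\mathbb{H}^{\mathsf T}\mathbb{H}$ for the eigenvalue $\sigma_i^2$; $v_{j,i}$ denotes the $i$-th entry of $\mathbf{v}_j$. Put $\mathbb{V}_1=[\mathbf{v}_1,\dots,\mathbf{v}_r]$ and $\widetilde{\mathbb{H}}=\operatorname{diag}(\sigma_1,\dots,\sigma_r)\mathbb{V}_1^{\mathsf T}\in\mathbb{R}^{r\times n_T}$ with columns $\widetilde{\mathbf{h}}_1,\dots,\widetilde{\mathbf{h}}_{n_T}$. ($\sigma$ without subscript is the noise standard deviation.) The original channel $\mathbf{Y}=\mathbb{H}\mathbf{X}+\mathbf{Z}'$, $\mathbf{Z}'\sim\mathcal{N}(\mathbf{0},\sigma^2\mathbb{I}_{n_R})$ independent of $\mathbf{X}$, is equivalent to $\widetilde{\mathbf{Y}}=\widetilde{\mathbb{H}}\mathbf{X}+\widetilde{\mathbf{Z}}$ with $\widetilde{\mathbf{Z}}\sim\mathcal{N}(\mathbf{0}_r,\sigma^2\mathbb{I}_r)$ independent of $\mathbf{X}$. The equal-cost constraints are $0\le X_k\le 1$ (almost surely) and $\mathbb{E}[X_k]=\alpha_k$ for all $k\in\{1,\dots,n_T\}$,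 and $\mathsf{C}_{\mathsf E}(\widetilde{\mathbb{H}},\boldsymbol{\alpha},\sigma)=\sup I(\mathbf{X};\widetilde{\mathbf{Y}})$, the supremum being over all laws of $\mathbf{X}$ satisfying the equal-cost constraints. Mutual information is in nats. The zonotope is $\mathcal{R}(\widetilde{\mathbb{H}})=\{\sum_{i=1}^{n_T}x_i\widetilde{\mathbf{h}}_i: x_i\in[0,1]\ \forall i\}$. $\mathbf{1}$ is the all-ones vector of length $n_T$. *)

(* Defs.v *)
From HB Require Import structures.
From mathcomp Require Import all_boot all_order all_algebra.
From mathcomp Require Import all_classical all_reals all_analysis.
From mathcomp Require Import measurable_realfun.

Set Implicit Arguments.
Unset Strict Implicit.
Unset Printing Implicit Defensive.

Import Order.TTheory GRing.Theory Num.Theory.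
Import numFieldNormedType.Exports.

Local Open Scope classical_set_scope.
Local Open Scope charge_scope.
Local Open Scope ring_scope.

(* The Borel sigma-algebra of R^n, presented as the product sigma-algebra, i.e.
   the one generated by the coordinates; this mirrors the library's instance
   on n.-tuple T. *)
Definition cV_display : measure_display. Proof. exact: default_measure_display. Qed.

Section measurable_cV.
Context (R : realType) (n : nat).

Let coors : 'I_n -> 'cV[R]_n -> R := fun i x => x i 0.

Let cV_set0 : g_sigma_preimage coors set0.
Proof. exact: sigma_algebra0. Qed.

Let cV_setC A : g_sigma_preimage coors A -> g_sigma_preimage coors (~` A).
Proof. exact: sigma_algebraC. Qed.

Let cV_bigcup (F : (set 'cV[R]_n)^nat) : (forall i, g_sigma_preimage coors (F i)) ->
  g_sigma_preimage coors (\bigcup_i (F i)).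
Proof. exact: sigma_algebra_bigcup. Qed.

HB.instance Definition _ := @isMeasurable.Build cV_display
  'cV[R]_n (g_sigma_preimage coors) cV_set0 cV_setC cV_bigcup.

Lemma measurable_coord (i : 'I_n) :
  measurable_fun [set: 'cV[R]_n] (fun x : 'cV[R]_n => x i 0).
Proof.
move=> _ Y mY; rewrite setTI; apply: sub_sigma_algebra => /=.
rewrite -bigcup_seq/=; exists i => /=; first by rewrite mem_index_enum.
by exists Y => //; rewrite setTI.
Qed.

Lemma measurable_fun_coordP d (T : measurableType d) (f : T -> 'cV[R]_n) :
  measurable_fun [set: T] f <->
  forall i, measurable_fun [set: T] (fun x => f x i 0).
Proof.
split=> [mf i|mf].
  exact: (measurableT_comp (measurable_coord i) mf).
apply: (measurability (\big[setU/set0]_(i < n)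
  preimage_set_system [set: 'cV[R]_n] (coors i) measurable)) => //.
move=> _ [B + <-]; rewrite -bigcup_seq => -[i _] [C mC <-].
by rewrite setTI; exact: (mf i).
Qed.

End measurable_cV.

Section product_probability.
Context d1 d2 (T1 : measurableType d1) (T2 : measurableType d2) (R : realType).
Variables (P : probability T1 R) (Q : probability T2 R).

Definition product_probability : set (T1 * T2) -> \bar R := (P \x Q)%E.

HB.instance Definition _ := Measure.on product_probability.

Let product_probability_setT : product_probability [set: T1 * T2] = 1%E.
Proof.
rewrite -setXTT [LHS]product_measure1E//.
by rewrite -[RHS]mule1; congr (_ * _)%E; exact: probability_setT.
Qed.

HB.instance Definition _ := Measure_isProbability.Build _ _ _
  product_probability product_probability_setT.

End product_probability.

Section pair_mfun.
Context d d1 d2 (T : measurableType d) (T1 : measurableType d1)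
  (T2 : measurableType d2) (X : {mfun T >-> T1}) (Y : {mfun T >-> T2}).

Definition pair_mfun (w : T) : T1 * T2 := (X w, Y w).

Let measurable_pair_mfun : measurable_fun [set: T] pair_mfun.
Proof. by apply: measurable_fun_pair. Qed.

HB.instance Definition _ :=
  isMeasurableFun.Build _ _ _ _ pair_mfun measurable_pair_mfun.

End pair_mfun.

(* D(P || Q), in nats.  The derivative is finite-valued, and the junk value of
   ln at nonpositive reals is only met on a P-null set. *)
Definition relative_entropy d (T : measurableType d) (R : realType)
    (P Q : probability T R) : \bar R :=
  if `[< P `<< Q >] then
    (\int[P]_x (ln (fine (('d (charge_of_finite_measure P) '/d Q) x)))%:E)%E
  else +oo%E.

Definition mutual_information d d1 d2 (T : measurableType d)
    (T1 : measurableType d1) (T2 : measurableType d2) (R : realType)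
    (P : probability T R) (X : {RV P >-> T1}) (Y : {RV P >-> T2}) : \bar R :=
  relative_entropy (distribution P (pair_mfun X Y))
    (product_probability (distribution P X) (distribution P Y)).

Section gaussian_vector.
Context (R : realType).

Definition cV_cons n (w : measurableTypeR R * 'cV[R]_n) : 'cV[R]_n.+1 :=
  col_mx w.1%:M w.2.

Lemma cV_cons0 n w : @cV_cons n w ord0 0 = w.1.
Proof.
rewrite /cV_cons (_ : ord0 = lshift n (ord0 : 'I_1)); last exact/val_inj.
by rewrite (@col_mxEu _ 1) mxE eqxx.
Qed.

Lemma cV_consS n w i : @cV_cons n w (lift ord0 i) 0 = w.2 i 0.
Proof.
rewrite /cV_cons (_ : lift ord0 i = rshift 1 i); last exact/val_inj.
by rewrite (@col_mxEd _ 1).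
Qed.

Let measurable_cV_cons n : measurable_fun setT (@cV_cons n).
Proof.
apply/measurable_fun_coordP => i; case: (unliftP ord0 i) => [j|] ->.
  under eq_fun do rewrite cV_consS.
  exact: (measurableT_comp (measurable_coord j)).
under eq_fun do rewrite cV_cons0.
exact: measurable_fst.
Qed.

HB.instance Definition _ n :=
  isMeasurableFun.Build _ _ _ _ (@cV_cons n) (@measurable_cV_cons n).

(* The law N(0, s^2 I_n): n independent coordinates of law N(0, s^2), where s
   is the standard deviation. *)
Fixpoint gaussian_vector (s : R) (n : nat) : probability 'cV[R]_n R :=
  if n is n'.+1 then
    distribution (product_probability (normal_prob 0 s) (gaussian_vector s n'))
      (@cV_cons n')
  else dirac (0 : 'cV[R]_0).

End gaussian_vector.

Lemma gaussian_vector_box (R : realType) (s : R) (n : nat) (A : 'I_n -> set R) :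
  (forall i, measurable (A i)) ->
  gaussian_vector s n [set x | forall i, A i (x i 0)] =
    (\prod_(i < n) normal_prob 0 s (A i))%E.
Proof.
elim: n A => [|n ih] A mA.
  rewrite big_ord0 /= diracE mem_set//= => -[].
  by [].
rewrite big_ord_recl -ih//=.
rewrite /distribution /pushforward /=.
have mB : measurable [set x : 'cV[R]_n | forall i, A (lift ord0 i) (x i 0)].
  rewrite (_ : [set x | _] =
      \bigcap_(i in [set: 'I_n]) ((fun x : 'cV[R]_n => x i 0) @^-1` A (lift ord0 i))).
    apply: fin_bigcap_measurable; first exact: finite_finset.
    by move=> i _; rewrite -[X in measurable X]setTI; exact: measurable_coord.
  by apply/seteqP; split => [x /= h i _|x /= h i]; apply: h.
rewrite -(product_measure1E (normal_prob 0 s) (gaussian_vector s n) (mA ord0) mB).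
congr ((_ \x _)%E _); apply/seteqP; split => -[a x] /=.
- move=> h; split=> [|i]; first by have := h ord0; rewrite cV_cons0.
  by have := h (lift ord0 i); rewrite cV_consS.
- by move=> [h0 h] i; case: (unliftP ord0 i) => [j|] ->; rewrite ?cV_consS ?cV_cons0.
Qed.

(* The additive Gaussian noise channel Y = g(X) + Z with X of law P and
   Z ~ N(0, s^2 I_m) independent of X, realized on the product space of the
   laws of X and Z. *)
Section gaussian_channel.
Context (R : realType) (n m : nat).

Definition channel_input (w : 'cV[R]_n * 'cV[R]_m) : 'cV[R]_n := w.1.

Definition channel_output (g : {mfun 'cV[R]_n >-> 'cV[R]_m})
  (w : 'cV[R]_n * 'cV[R]_m) : 'cV[R]_m := g w.1 + w.2.

HB.instance Definition _ := isMeasurableFun.Build _ _ _ _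
  channel_input measurable_fst.

Let measurable_channel_output g : measurable_fun setT (channel_output g).
Proof.
apply/measurable_fun_coordP => i.
rewrite (_ : (fun w => _) =
    (fun w : 'cV[R]_n * 'cV[R]_m => g w.1 i 0 + w.2 i 0)); last first.
  by apply/funext => w; rewrite /channel_output mxE.
apply: measurable_funD.
  apply: (measurableT_comp (measurable_coord i)).
  exact: measurableT_comp.
exact: (measurableT_comp (measurable_coord i)).
Qed.

HB.instance Definition _ g := isMeasurableFun.Build _ _ _ _
  (channel_output g) (measurable_channel_output g).

Definition channel_information (g : {mfun 'cV[R]_n >-> 'cV[R]_m}) (s : R)
    (P : probability 'cV[R]_n R) : \bar R :=
  mutual_information (P := product_probability P (gaussian_vector s m))
    channel_input (channel_output g).

End gaussian_channel.

Section linear_mfun.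
Context (R : realType) (n m : nat).

Definition linear_map (A : 'M[R]_(m, n)) (x : 'cV[R]_n) : 'cV[R]_m := A *m x.

Let measurable_linear_map A : measurable_fun setT (linear_map A).
Proof.
apply/measurable_fun_coordP => i.
rewrite (_ : (fun x => _) =
    (fun x : 'cV[R]_n => \sum_(j < n) A i j * x j 0)); last first.
  by apply/funext => x; rewrite /linear_map mxE.
apply: measurable_sum => j; apply: measurable_funM => //.
exact: measurable_coord.
Qed.

HB.instance Definition _ A := isMeasurableFun.Build _ _ _ _
  (linear_map A) (measurable_linear_map A).

Definition identity_map (x : 'cV[R]_n) : 'cV[R]_n := x.

HB.instance Definition _ := isMeasurableFun.Build _ _ _ _
  identity_map (@measurable_id _ _ setT).

End linear_mfun.

(* sv lists the nonzero singular values of H in nonincreasing order, with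
   multiplicity: their squares are the nonzero roots of char_poly (H^T H). *)
Definition nonzero_singular_values (R : realType) (m n r : nat)
    (H : 'M[R]_(m, n)) (sv : 'rV[R]_r) : Prop :=
  [/\ forall i, 0 < sv 0 i,
      forall i j : 'I_r, (i <= j)%N -> sv 0 j <= sv 0 i &
      char_poly (H^T *m H) =
        'X^(n - r) * \prod_(i < r) ('X - (sv 0 i ^+ 2)%:P)].

Section reduced_channel.
Context (R : realType) (r : nat) (V : 'M[R]_r.+1) (sv : 'rV[R]_r).

Definition first_columns : 'M[R]_(r.+1, r) := colsub (widen_ord (leqnSn r)) V.

Definition last_column : 'cV[R]_r.+1 := col ord_max V.

Definition reduced_channel : 'M[R]_(r, r.+1) := diag_mx sv *m first_columns^T.

(* Only the i with a nonzero last_column entry enter the maximum; it is taken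
   in \bar R, where -oo is neutral, and is finite as soon as such an i exists. *)
Definition fmin (s : 'cV[R]_r) : R :=
  fine (\big[maxe/-oo%E]_(i < r.+1 | last_column i 0 != 0)
    ((1 - Num.sg (last_column i 0)) / (2 * last_column i 0) -
     \sum_(j < r) first_columns i j * s j 0 /
                  (last_column i 0 * sv 0 j))%:E).

End reduced_channel.

Definition zonotope (R : realType) (m n : nat) (A : 'M[R]_(m, n)) : set 'cV[R]_m :=
  [set s | exists x : 'I_n -> R,
     (forall i, 0 <= x i <= 1) /\ s = \sum_(i < n) x i *: col i A].

Definition law_support (R : realType) (n : nat) (P : probability 'cV[R]_n R) :
    set 'cV[R]_n :=
  [set x | forall U : set 'cV[R]_n, open U -> U x -> (0 < P U)%E].

Definition has_mean (R : realType) (n : nat) (P : probability 'cV[R]_n R)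
    (mu : 'cV[R]_n) : Prop :=
  forall k, 'E_P[fun x : 'cV[R]_n => (x k 0)%R]%E = (mu k 0)%:E.

Definition equal_cost (R : realType) (n : nat) (alpha : 'cV[R]_n)
    (P : probability 'cV[R]_n R) : Prop :=
  {ae P, forall x : 'cV[R]_n, forall k, 0 <= x k 0 <= 1} /\ has_mean P alpha.

Definition equal_cost_capacity (R : realType) (m n : nat) (A : 'M[R]_(m, n))
    (alpha : 'cV[R]_n) (s : R) : \bar R :=
  ereal_sup [set channel_information (linear_map A) s P |
    P in [set P : probability 'cV[R]_n R | equal_cost alpha P]].

(* Main.v *)
(* The fibre of the reduced channel over s is the line {W s + t v}, where v is
   the last column of V and W a right inverse of the reduced channel, and it
   meets the unit cube in fmin s <= t <= fmax s, with
   fmax s = v^T 1 - fmin (Ht 1 - s).  Hence laws of X on the cube with mean alpha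
   push forward to the laws of S satisfying the moment constraints; conversely
   such an S lifts to W S + (lambda fmin S + (1 - lambda) fmax S) v, where lambda
   in [0, 1] is a constant adjusting the mean of the last coordinate to
   v^T alpha.
   The mutual information is the same on both sides since the output depends on X
   only through S: if h is the density of the law of (S, Y) with respect to the
   product of its marginals, then h (Ht x, y) is that of the law of (X, Y), so no
   explicit Gaussian density is needed. *)
From HB Require Import structures.
Require Import Defs.
From mathcomp Require Import all_boot all_order all_algebra.
From mathcomp Require Import all_classical all_reals all_analysis.
From mathcomp Require Import measurable_realfun ring lra.

Set Implicit Arguments.
Unset Strict Implicit.
Unset Printing Implicit Defensive.

Import Order.TTheory GRing.Theory Num.Theory.
Import numFieldNormedType.Exports.

Local Open Scope classical_set_scope.
Local Open Scope ring_scope.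

(** * Densities, Tonelli on rectangles, and uniqueness of measures on a product *)

Section density_measure.
Local Open Scope ereal_scope.
Context d (T : measurableType d) (R : realType).
Variables (mu : {measure set T -> \bar R}) (f : T -> \bar R).

(* The two proofs are arguments so that the measure instance can be inferred. *)
Definition density_measure of measurable_fun [set: T] f & (forall x, 0 <= f x) :=
  fun A : set T => \int[mu]_(x in A) f x.

Hypotheses (mf : measurable_fun [set: T] f) (f_ge0 : forall x, 0 <= f x).

Let density_measure0 : density_measure mf f_ge0 set0 = 0.
Proof. exact: integral_set0. Qed.

Let density_measure_ge0 A : 0 <= density_measure mf f_ge0 A.
Proof. exact: integral_ge0. Qed.

HB.instance Definition _ := isMeasure.Build _ _ _ (density_measure mf f_ge0)
  density_measure0 density_measure_ge0 (semi_sigma_additive_nng_induced mf f_ge0).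

End density_measure.

Section tonelli_rectangle.
Local Open Scope ereal_scope.
Context d1 d2 (T1 : measurableType d1) (T2 : measurableType d2) (R : realType).
Variables (m1 : {sigma_finite_measure set T1 -> \bar R})
  (m2 : {sigma_finite_measure set T2 -> \bar R}) (f : T1 * T2 -> \bar R).
Hypotheses (mf : measurable_fun setT f) (f_ge0 : forall z, 0 <= f z).

Let restrict_ge0 D z : 0 <= (f \_ D) z.
Proof. by rewrite patchE; case: ifP => _; [exact: f_ge0|exact: lexx]. Qed.

Let measurable_restrict_f D : measurable D -> measurable_fun setT (f \_ D).
Proof.
move=> mD; apply: (iffLR (measurable_restrictT f mD)). exact: measurable_funTS.
Qed.

Let restrict_section A B x :
  \int[m2]_y (f \_ (A `*` B)) (x, y) =
  ((fun x => \int[m2]_(y in B) f (x, y)) \_ A) x.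
Proof.
rewrite patchE; case: ifPn => [/set_mem|] xA.
  rewrite [RHS]integral_mkcond; apply: eq_integral => y _.
  by rewrite !patchE in_setX/= (mem_set xA).
transitivity (0 : \bar R) => //.
by apply: integral0_eq => y _; rewrite patchE in_setX/= (negbTE xA).
Qed.

(** Extending [f] by zero outside a rectangle reduces sections over [B] to sections over the whole
    factor, where Fubini-Tonelli applies. *)
Lemma measurable_integral_section B : measurable B ->
  measurable_fun setT (fun x => \int[m2]_(y in B) f (x, y)).
Proof.
move=> mB; have mTB : measurable ([set: T1] `*` B) by exact: measurableX.
have := measurable_fun_fubini_tonelli_F (m2 := m2) _ (measurable_restrict_f mTB)
  (restrict_ge0 _).
apply: eq_measurable_fun => x _.
by rewrite [LHS]restrict_section patchE in_setT.
Qed.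

Lemma integral_setX_tonelli A B : measurable A -> measurable B ->
  \int[m1 \x m2]_(z in A `*` B) f z =
  \int[m1]_(x in A) \int[m2]_(y in B) f (x, y).
Proof.
move=> mA mB; have mAB : measurable (A `*` B) by exact: measurableX.
rewrite [LHS]integral_mkcond.
rewrite [LHS](fubini_tonelli1 _ (measurable_restrict_f mAB) (restrict_ge0 _)).
rewrite [RHS]integral_mkcond; apply: eq_integral => x _.
exact: restrict_section.
Qed.

End tonelli_rectangle.

(** Rectangles are closed under intersection and generate the product sigma-algebra, and the whole
    space is a rectangle of finite mass. *)
Lemma measure_prod_unique d1 d2 (T1 : measurableType d1) (T2 : measurableType d2)
    (R : realType) (mu : probability (T1 * T2)%type R)
    (nu : {measure set (T1 * T2) -> \bar R}) :
  (forall A B, measurable A -> measurable B -> mu (A `*` B) = nu (A `*` B)) ->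
  forall C, measurable C -> mu C = nu C.
Proof.
move=> munu C mC.
pose G := [set A `*` B | A in @measurable _ T1 & B in @measurable _ T2].
apply: (measure_unique G (fun=> [set: T1 * T2])) => //.
- by rewrite measurable_prod_measurableType.
- move=> _ _ [X1 mX1 [X2 mX2 <-]] [Y1 mY1 [Y2 mY2 <-]].
  exists (X1 `&` Y1); first exact: measurableI.
  by exists (X2 `&` Y2); [exact: measurableI|rewrite setXI].
- by move=> _; exists setT => //; exists setT => //; rewrite setXTT.
- by rewrite bigcup_const.
- by move=> _ [A mA [B mB <-]]; exact: munu.
- by move=> _; apply: (le_lt_trans (probability_le1 mu measurableT));
  rewrite ltry.
Qed.

(** * Change of variables and relative entropy under pushforward *)

Section distribution_transfer.
Context d d' (T : measurableType d) (T' : measurableType d') (R : realType).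
Variables (P : probability T R) (phi : {mfun T >-> T'}).

Lemma ae_distribution (p : T' -> Prop) :
  {ae distribution P phi, forall y, p y} -> {ae P, forall x, p (phi x)}.
Proof.
move=> [N [mN N0 sub]]; exists (phi @^-1` N); split => //.
  by rewrite -[X in measurable X]setTI; exact: measurable_funP.
by move=> x /= h; exact: sub.
Qed.

(** Positive and negative parts are transferred separately, so [f] may be signed and
    non-integrable. *)
Lemma integral_distributionT (f : T' -> \bar R) : measurable_fun setT f ->
  (\int[distribution P phi]_y f y = \int[P]_x (f \o phi) x)%E.
Proof.
move=> mf; rewrite integralE [RHS]integralE; congr (_ - _)%E.
- rewrite ge0_integral_distribution;
    [rewrite (funepos_comp f phi)//|exact: measurable_funepos|by []].
- rewrite ge0_integral_distribution;
    [rewrite (funeneg_comp f phi)//|exact: measurable_funeneg|by []].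
Qed.

End distribution_transfer.

Section relative_entropy_pushforward.
Local Open Scope charge_scope.
Context d d' (T : measurableType d) (T' : measurableType d') (R : realType).
Variables (phi : {mfun T >-> T'}) (P Q : probability T R) (P' Q' : probability T' R).
Hypothesis P'E : forall C, measurable C -> P' C = P (phi @^-1` C).
Hypothesis Q'E : forall C, measurable C -> Q' C = Q (phi @^-1` C).
Hypothesis density : P' `<< Q' -> forall C, measurable C ->
  P C = (\int[Q]_(x in C) (Radon_Nikodym_SigmaFinite.f P' Q' \o phi) x)%E.

(** By [density], the likelihood ratio of [P] and [Q] is a function of [phi], so [phi] is a
    sufficient statistic and passing to the image loses no divergence. *)
Lemma relative_entropy_pushforward : relative_entropy P Q = relative_entropy P' Q'.
Proof.
have mphi C : measurable C -> measurable (phi @^-1` C).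
  by move=> mC; rewrite -[X in measurable X]setTI; exact: measurable_funP.
rewrite /relative_entropy.
have [PQ'|nPQ'] := pselect (P' `<< Q'); last first.
  (* A null set of [Q'] charged by [P'] pulls back to a null set of [Q] charged by [P], so both
     divergences are infinite. *)
  rewrite (asboolF nPQ') asboolF// => /null_content_dominatesP PQ.
  apply: nPQ'; apply/null_content_dominatesP => C mC C0.
  apply: etrans (P'E mC) _; apply: PQ; first exact: mphi.
  exact: etrans (esym (Q'E mC)) C0.
have mRN d0 (T0 : measurableType d0) (A B : probability T0 R) : A `<< B ->
    measurable_fun setT ('d (charge_of_finite_measure A) '/d B).
  move=> AB; apply: (measurable_int B).
  exact: (@Radon_Nikodym_integrable _ _ _ (charge_of_finite_measure A) B AB).
(* This version of the derivative is nonnegative everywhere, not just almost everywhere, so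
   [h \o phi] is nonnegative as well. *)
pose h := Radon_Nikodym_SigmaFinite.f P' Q'.
have mh : measurable_fun setT h.
  exact: measurable_int (Radon_Nikodym_SigmaFinite.f_integrable PQ').
have h0 : forall x, (0 <= h x)%E by exact: Radon_Nikodym_SigmaFinite.f_ge0.
have PQ : P `<< Q.
  apply/null_content_dominatesP => C mC C0; rewrite density//.
  apply: null_set_integral => //.
    by apply: measurable_funTS; exact: measurableT_comp.
rewrite !asboolT//.
pose L (x : \bar R) := ((ln (fine x))%:E)%E.
have mL d0 (T0 : measurableType d0) (k : T0 -> \bar R) :
    measurable_fun setT k -> measurable_fun setT (L \o k).
  move=> mk; apply: measurableT_comp => //.
  apply: measurableT_comp => //.
  exact: measurableT_comp.
have RN' : ae_eq Q' setT h ('d (charge_of_finite_measure P') '/d Q').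
  exact: ae_eq_Radon_Nikodym_SigmaFinite.
have RN : ae_eq Q setT (h \o phi) ('d (charge_of_finite_measure P) '/d Q).
  apply: integral_ae_eq => //.
  - apply/integrableP; split; first exact: measurableT_comp.
    under eq_integral do rewrite gee0_abs ?h0//.
    by rewrite -density// probability_setT ltry.
  - by move=> E _ mE; rewrite -density// -Radon_Nikodym_integral.
(* The two derivatives are replaced by [h \o phi] and [h]; the equalities hold [Q]- and [Q']-almost
   everywhere, hence also for the dominated measures [P] and [P']. *)
transitivity (\int[P]_x ((L \o h) \o phi) x)%E.
  apply: ae_eq_integral => //.
  - exact/mL/mRN.
  - by apply: measurableT_comp => //; exact: mL.
  - apply: (ae_eq_comp2 (fun _ => L)).
    exact: null_dominates_ae_eq (ae_eq_sym RN).
transitivity (\int[P']_x (L \o h) x)%E.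
  rewrite -integral_distributionT; last exact: mL.
  by apply: eq_measure_integral => A mA _; exact/esym/P'E.
apply: ae_eq_integral => //.
- exact: mL.
- exact/mL/mRN.
- by apply: (ae_eq_comp2 (fun _ => L)); apply: null_dominates_ae_eq RN'.
Qed.

End relative_entropy_pushforward.


Section relative_entropy_markov.
Local Open Scope ereal_scope.
Context d1 d2 d3 (T1 : measurableType d1) (T2 : measurableType d2)
  (T3 : measurableType d3) (R : realType).
Variables (P : probability T1 R) (g : {mfun T1 >-> T2}) (Q : probability T3 R).
Variables (J : probability (T1 * T3)%type R) (J' : probability (T2 * T3)%type R).
(** [K B s] stands for the probability that the output lies in [B] given the state [s]. Both joint
    laws are built from this one kernel, so the output depends on the input only through [g]. *)
Variable K : set T3 -> T2 -> \bar R.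
Hypothesis K_ge0 : forall B s, 0 <= K B s.
Hypothesis mK : forall B, measurable B -> measurable_fun setT (K B).
Hypothesis JE : forall A B, measurable A -> measurable B ->
  J (A `*` B) = \int[P]_(x in A) K B (g x).
Hypothesis J'E : forall A B, measurable A -> measurable B ->
  J' (A `*` B) = \int[distribution P g]_(s in A) K B s.

Let phi (w : T1 * T3) : T2 * T3 := (g w.1, w.2).

Let mphi : measurable_fun setT phi.
Proof.
by apply: measurable_fun_pair => //; exact: measurableT_comp.
Qed.

HB.instance Definition _ := isMeasurableFun.Build _ _ _ _ phi mphi.

Let preimage_phi A B : phi @^-1` (A `*` B) = (g @^-1` A) `*` B.
Proof. by []. Qed.

Let mpreimage A : measurable A -> measurable (g @^-1` A).
Proof. by move=> mA; rewrite -[X in measurable X]setTI; exact: measurable_funP. Qed.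

(* If J' has a density h with respect to the product of its marginals, then
   K B s is the integral over B of h (s, _) for almost every s; substituting
   g x for s shows that h o (g, id) is a density for J. *)
Lemma relative_entropy_markov :
  relative_entropy J (product_probability P Q) =
  relative_entropy J' (product_probability (distribution P g) Q).
Proof.
apply: (@relative_entropy_pushforward _ _ _ _ _ phi).
- apply: (measure_prod_unique (mu := J') (nu := distribution J phi)).
  move=> A B mA mB; rewrite J'E// /= /distribution /pushforward preimage_phi.
  rewrite JE//; last exact: mpreimage.
  by rewrite ge0_integral_pushforward//; exact: measurable_funTS (mK mB).
- apply: (measure_prod_unique
    (mu := product_probability (distribution P g) Q)
    (nu := distribution (product_probability P Q) phi)).
  move=> A B mA mB; rewrite /= /distribution /pushforward preimage_phi.
  rewrite /product_probability !product_measure1E//; exact: mpreimage.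
move=> J'PQ.
pose h := Radon_Nikodym_SigmaFinite.f J' (product_probability (distribution P g) Q).
have hint := Radon_Nikodym_SigmaFinite.f_integrable J'PQ.
have mh : measurable_fun setT h by exact: measurable_int hint.
have h_ge0 : forall x, 0 <= h x by exact: Radon_Nikodym_SigmaFinite.f_ge0.
have mhphi : measurable_fun setT (h \o phi) by exact: measurableT_comp.
have hphi_ge0 x : 0 <= (h \o phi) x by exact: h_ge0.
move=> C mC.
(* Seen as a measure, the right-hand side need only be compared with [J] on rectangles. *)
rewrite [RHS](_ : _ =
  density_measure (product_probability P Q) mhphi hphi_ge0 C) //.
apply: measure_prod_unique mC => A B mA mB.
pose k s := \int[Q]_(y in B) h (s, y).
have mk : measurable_fun setT k by exact: measurable_integral_section.
have k_ge0 s : 0 <= k s by exact: integral_ge0.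
have kK : ae_eq (distribution P g) setT (K B) k.
  apply: integral_ae_eq => //.
  - apply/integrableP; split; first exact: mK.
    under eq_integral do rewrite gee0_abs//.
    rewrite -J'E//; apply: le_lt_trans (ltry 1); apply: probability_le1.
    exact: measurableX.
  - move=> A' _ mA'; rewrite -J'E//.
    rewrite (Radon_Nikodym_SigmaFinite.f_integral J'PQ) //;
      last exact: measurableX.
    exact: (integral_setX_tonelli (distribution P g) Q mh h_ge0 mA' mB).
rewrite JE//= /density_measure.
rewrite [RHS](integral_setX_tonelli P Q mhphi hphi_ge0 mA mB).
apply: ae_eq_integral => //.
- by apply: measurable_funTS; apply: measurableT_comp => //; exact: mK.
- by apply: measurable_funTS; exact: (measurableT_comp mk).
have : {ae P, forall x, setT (g x) -> K B (g x) = k (g x)}.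
  exact: ae_distribution kK.
by apply: filterS => x /(_ I).
Qed.

End relative_entropy_markov.

(** The chosen derivative depends on [Q] as a structure, so agreement on measurable sets is not
    convertible to equality; the pushforward lemma along the identity bridges the gap. *)
Lemma relative_entropy_ext d (T : measurableType d) (R : realType)
    (P Q Q' : probability T R) :
  (forall C, measurable C -> Q C = Q' C) ->
  relative_entropy P Q = relative_entropy P Q'.
Proof.
move=> QQ'; pose midmix :=
  isMeasurableFun.Build _ _ _ _ (@idfun T) (@measurable_id _ _ setT).
pose phi : {mfun T >-> T} := HB.pack (@idfun T) midmix.
apply: (relative_entropy_pushforward (phi := phi)) => //.
  by move=> C mC; rewrite QQ'.
move=> PQ' C mC; rewrite (Radon_Nikodym_SigmaFinite.f_integral PQ')//.
by apply: eq_measure_integral => A mA _; exact/esym/QQ'.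
Qed.

Lemma product_probability_ext d1 d2 (T1 : measurableType d1)
    (T2 : measurableType d2) (R : realType) (P P' : probability T1 R)
    (Q Q' : probability T2 R) :
  (forall A, measurable A -> P A = P' A) ->
  (forall B, measurable B -> Q B = Q' B) ->
  forall C, measurable C ->
    product_probability P Q C = product_probability P' Q' C.
Proof.
move=> PP' QQ'; apply: measure_prod_unique => A B mA mB.
rewrite /= /product_probability !product_measure1E//.
by congr (_ * _)%E; [exact: PP'|exact: QQ'].
Qed.

(** * Laws of the Gaussian channel *)

Section channel_law.
Local Open Scope ereal_scope.
Context (R : realType) (m : nat) (sigma : R).

Let N : probability 'cV[R]_m R := gaussian_vector sigma m.

(** The transition kernel of the channel: the noise law translated by the noiseless signal [s]. *)
Definition channel_kernel (B : set 'cV[R]_m) (s : 'cV[R]_m) : \bar R :=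
  N [set z | B (s + z)%R].

Let kernelE B s : channel_kernel B s =
  N (xsection (channel_output (@identity_map R m) @^-1` B) s).
Proof. by congr (N _); apply/seteqP; split => z; rewrite /xsection/= inE. Qed.

Lemma measurable_channel_kernel B : measurable B ->
  measurable_fun setT (channel_kernel B).
Proof.
move=> mB; rewrite (funext (kernelE B)); apply: measurable_fun_xsection.
by rewrite -[X in measurable X]setTI; exact: measurable_funP.
Qed.

(** The product measure integrates the noise mass of sections; the section at [x] of the event is a
    noise event when [x] is in [A] and empty otherwise. *)
Lemma channel_joint_law n (g : {mfun 'cV[R]_n >-> 'cV[R]_m})
    (P : probability 'cV[R]_n R) A B : measurable A -> measurable B ->
  distribution (product_probability P N)
    (pair_mfun (@channel_input R n m) (channel_output g)) (A `*` B) =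
  \int[P]_(x in A) channel_kernel B (g x).
Proof.
move=> mA mB; rewrite [RHS]integral_mkcond.
apply: eq_integral => x _; rewrite /= patchE; case: ifPn => [/set_mem|] xA.
  by congr (N _); apply/seteqP; split => z; rewrite /xsection/= inE// => -[].
rewrite (_ : xsection _ _ = set0) ?measure0//.
apply/seteqP; split => z//; rewrite /xsection/= inE => -[xA' _].
by move: xA; rewrite (mem_set xA').
Qed.

Lemma channel_output_law n (g : {mfun 'cV[R]_n >-> 'cV[R]_m})
    (P : probability 'cV[R]_n R) B : measurable B ->
  distribution (product_probability P N) (channel_output g) B =
  \int[P]_x channel_kernel B (g x).
Proof.
by move=> mB; rewrite -(channel_joint_law g P measurableT mB)/=;
  congr (product_probability _ _ _); apply/seteqP; split => // w [].
Qed.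

Lemma channel_input_law n (P : probability 'cV[R]_n R) A : measurable A ->
  distribution (product_probability P N) (@channel_input R n m) A = P A.
Proof.
move=> mA; rewrite /distribution /pushforward.
rewrite (_ : @channel_input R n m @^-1` A = A `*` setT); last first.
  by apply/seteqP; split => // w [].
rewrite -[RHS]mule1; apply: etrans (product_measure1E P N mA measurableT) _.
by congr (_ * _); exact: probability_setT.
Qed.

(** Both channels share [channel_kernel], evaluated at [g x] and at [s]. Agreement of [P'] with the
    pushforward on measurable sets is enough, so this serves laws that are pushed forward and laws
    that are lifted. *)
Lemma channel_information_pushforward n (g : {mfun 'cV[R]_n >-> 'cV[R]_m})
    (P : probability 'cV[R]_n R) (P' : probability 'cV[R]_m R) :
  (forall C, measurable C -> P' C = P (g @^-1` C)) ->
  channel_information g sigma P = channel_information (@identity_map R m) sigma P'.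
Proof.
move=> P'E; have int_P' A B : measurable A -> measurable B ->
    \int[P']_(s in A) channel_kernel B s =
    \int[distribution P g]_(s in A) channel_kernel B s.
  by move=> mA mB; apply: eq_measure_integral => C mC _; exact: P'E.
rewrite /channel_information /mutual_information.
(* The output law is common to both channels; the other marginals are exchanged by
   extensionality. *)
pose Q := distribution (product_probability P N) (channel_output g).
set J := distribution _ _; set J' := distribution _ (pair_mfun _ _).
transitivity (relative_entropy J (product_probability P Q)).
  by apply: relative_entropy_ext; apply: product_probability_ext => // A mA;
    exact: channel_input_law.
transitivity (relative_entropy J' (product_probability (distribution P g) Q)).
  apply: (@relative_entropy_markov _ _ _ _ _ _ _ _ _ _ _ _ channel_kernel) => //.
  - exact: measurable_channel_kernel.
  - by move=> A B mA mB; exact: channel_joint_law.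
  - move=> A B mA mB; rewrite -int_P'//.
    exact: (channel_joint_law (@identity_map R m)).
apply: relative_entropy_ext; apply: product_probability_ext => A mA.
  by apply: etrans (esym (channel_input_law P' mA)); exact/esym/P'E.
apply: etrans (channel_output_law g P mA) _.
apply: etrans (esym (channel_output_law (@identity_map R m) P' mA)).
rewrite /identity_map int_P'//.
by apply/esym/ge0_integral_distribution => //; exact: measurable_channel_kernel.
Qed.

End channel_law.

(** * Geometry of the fibres of the reduced channel in the cube *)

Section optical_channel.
Context (R : realType) (r : nat).
Variables (V : 'M[R]_r.+1) (sv : 'rV[R]_r).
Hypotheses (sv_gt0 : forall i, 0 < sv 0 i) (V_orth : V^T *m V = 1%:M).

Local Notation A := (first_columns V).
Local Notation v := (last_column V).
Local Notation Ht := (reduced_channel V sv).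
Local Notation ones := (const_mx 1 : 'cV[R]_r.+1).

Let col_orth i j : \sum_k V k i * V k j = (i == j)%:R.
Proof.
have := congr1 (fun M : 'M[R]_r.+1 => M i j) V_orth; rewrite !mxE => <-.
by apply: eq_bigr => k _; rewrite mxE.
Qed.

Let widen_neq_max (i : 'I_r) : (widen_ord (leqnSn r) i == ord_max) = false.
Proof. by apply/negP => /eqP/(congr1 val)/=/eqP; rewrite ltn_eqF. Qed.

(** The pseudoinverse of the reduced channel. *)
Definition lift_matrix : 'M[R]_(r.+1, r) :=
  A *m diag_mx (\row_j (sv 0 j)^-1).

Local Notation W := lift_matrix.

(** Inverse of the change of coordinates sending [x] to the pair of [Ht *m x] and [v^T *m x]. *)
Definition lift_at (s : 'cV[R]_r) (t : R) : 'cV[R]_r.+1 := W *m s + t *: v.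

Lemma lift_atE s t i : lift_at s t i 0 = (W *m s) i 0 + t * v i 0.
Proof. by rewrite mxE [(t *: v) i 0]mxE. Qed.

Lemma reduced_channelK : Ht *m W = 1%:M.
Proof.
have AA : A^T *m A = 1%:M.
  apply/matrixP => i j; rewrite !mxE.
  under eq_bigr do rewrite !mxE.
  by rewrite col_orth.
rewrite /reduced_channel /lift_matrix mulmxA -(mulmxA _ A^T A) AA mulmx1.
rewrite mulmx_diag; apply/matrixP => i j; rewrite !mxE.
by case: eqP => // ->; rewrite divff// gt_eqF.
Qed.

Lemma reduced_channel_last : Ht *m v = 0.
Proof.
rewrite /reduced_channel -mulmxA (_ : A^T *m v = 0) ?mulmx0//.
apply/matrixP => i j; rewrite !mxE.
under eq_bigr do rewrite !mxE.
by rewrite col_orth widen_neq_max.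
Qed.

Lemma reduced_channel_lift s t : Ht *m lift_at s t = s.
Proof.
by rewrite mulmxDr mulmxA reduced_channelK mul1mx -scalemxAr reduced_channel_last
  scaler0 addr0.
Qed.

Lemma last_lift s t : (v^T *m lift_at s t) 0 0 = t.
Proof.
have vA : v^T *m A = 0.
  apply/matrixP => i j; rewrite !mxE; under eq_bigr do rewrite !mxE.
  by rewrite col_orth eq_sym widen_neq_max.
rewrite mulmxDr /lift_matrix !mulmxA vA !mul0mx add0r -scalemxAr !mxE.
by under eq_bigr do rewrite !mxE; rewrite col_orth eqxx mulr1.
Qed.

Lemma lift_reduced_channel x : lift_at (Ht *m x) ((v^T *m x) 0 0) = x.
Proof.
rewrite /lift_at mulmxA /lift_matrix /reduced_channel.
rewrite mulmxA -(mulmxA A) mulmx_diag.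
rewrite (_ : diag_mx _ = 1%:M); last first.
  apply/matrixP => i j; rewrite !mxE.
  by case: eqP => // ->; rewrite mulVf// gt_eqF.
rewrite mulmx1 -mul_mx_scalar -mx11_scalar mulmxA -mulmxDl.
(* The identity is expanded as [V *m V^T], a sum over columns from which the last one is split
   off. *)
rewrite (_ : _ + _ = 1%:M) ?mul1mx// -(mulmx1C V_orth).
apply/matrixP => i j; rewrite !mxE [in RHS]big_ord_recr/= big_ord1 !mxE.
congr (_ + _).
by apply: eq_bigr => k _; rewrite !mxE.
Qed.

Lemma last_column_neq0 : exists i, v i 0 != 0.
Proof.
apply/existsP; apply/contraT; rewrite negb_exists => /forallP v0.
have := col_orth ord_max ord_max; rewrite eqxx big1 => [/esym/eqP|k _].
  by rewrite oner_eq0.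
by have := v0 k; rewrite mxE negbK => /eqP ->; rewrite mul0r.
Qed.

Let fmin_term (s : 'cV[R]_r) i : R :=
  (1 - Num.sg (v i 0)) / (2 * v i 0) -
  \sum_(j < r) A i j * s j 0 / (v i 0 * sv 0 j).

Lemma fmin_leP s t :
  fmin V sv s <= t <-> forall i, v i 0 != 0 -> fmin_term s i <= t.
Proof.
have [i0 vi0] := last_column_neq0.
rewrite /fmin; set M := \big[_/_]_(_ | _) _.
have Mle (u : R) : (M <= u%:E)%E <-> forall i, v i 0 != 0 -> fmin_term s i <= u.
  split=> [/bigmax_leP[_ h] i vi|h]; first by rewrite -lee_fin; exact: h.
  by apply/bigmax_leP; split => [|i vi]; rewrite ?leNye// lee_fin h.
(* [fine] is harmless: some entry of [v] is nonzero, so the maximum is not [-oo], and finitely many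
   real terms keep it below [+oo]. *)
have Mfin : M \is a fin_num.
  rewrite fin_numE; apply/andP; split.
    apply/eqP => MNy; have := (Mle (fmin_term s i0 - 1)).1.
    rewrite MNy leNye => /(_ isT i0 vi0).
    by rewrite lerBrDr gerDl ler10.
  apply/eqP => My; have : (M <= (\sum_i `|fmin_term s i|)%:E)%E.
    apply/Mle => i _; apply: (le_trans (ler_norm _)).
    by rewrite (bigD1 i)//= lerDl sumr_ge0.
  by rewrite My.
by rewrite -Mle -[in X in _ <-> X](fineK Mfin) lee_fin.
Qed.

(** Dividing a box constraint on coordinate [i] by [v i 0] bounds [t] from below; the sign of
    [v i 0] decides which of the bounds 0 and 1 does so, and [(1 - Num.sg (v i 0)) / 2] is that
    bound. *)
Let fmin_termE s t i : v i 0 != 0 ->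
  (fmin_term s i <= t) = if 0 < v i 0 then 0 <= lift_at s t i 0
                         else lift_at s t i 0 <= 1.
Proof.
move=> vi.
have -> : fmin_term s i = ((1 - Num.sg (v i 0)) / 2 - (W *m s) i 0) / v i 0.
  rewrite /fmin_term [RHS]mulrBl; congr (_ - _); first by rewrite invfM mulrA.
  rewrite [(W *m s) i 0]mxE mulr_suml; apply: eq_bigr => j _.
  rewrite /lift_matrix mul_mx_diag !mxE invfM; ring.
rewrite lift_atE.
case: ltrgtP vi => // vi _.
- rewrite gtr0_sg// subrr mul0r sub0r ler_pdivrMr//.
  by rewrite -subr_ge0 opprK addrC.
- rewrite ltr0_sg// opprK -[1 + 1]/(2%:R) divff// ler_ndivrMr//.
  by rewrite lerBrDr addrC.
Qed.

Lemma fmin_le_lift s t i : fmin V sv s <= t ->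
  (0 < v i 0 -> 0 <= lift_at s t i 0) /\ (v i 0 < 0 -> lift_at s t i 0 <= 1).
Proof.
move=> /fmin_leP/(_ i) st; split=> vi.
  by have := st (lt0r_neq0 vi); rewrite fmin_termE ?gt_eqF// vi.
by have := st (ltr0_neq0 vi); rewrite fmin_termE ?lt_eqF// ltNge ltW.
Qed.

Lemma fmin_le_last (x : 'cV[R]_r.+1) : (forall i, 0 <= x i 0 <= 1) ->
  fmin V sv (Ht *m x) <= (v^T *m x) 0 0.
Proof.
move=> x01; apply/fmin_leP => i vi; rewrite fmin_termE// lift_reduced_channel.
by have /andP[? ?] := x01 i; case: ifP.
Qed.

(** The reflection of the cube through its centre swaps the bounds 0 and 1, which turns lower bounds
    on [t] into upper bounds. *)
Lemma lift_at_compl s t :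
  lift_at (Ht *m ones - s) ((v^T *m ones) 0 0 - t) = ones - lift_at s t.
Proof.
rewrite -[in RHS](lift_reduced_channel ones) /lift_at mulmxBr scalerBl.
by rewrite opprD addrACA.
Qed.

Lemma zonotopeP s : zonotope Ht s <->
  exists2 x : 'cV[R]_r.+1, (forall i, 0 <= x i 0 <= 1) & s = Ht *m x.
Proof.
have E (x : 'cV[R]_r.+1) : \sum_i x i 0 *: col i Ht = Ht *m x.
  apply/matrixP => i j; rewrite summxE !mxE ord1.
  by apply: eq_bigr => k _; rewrite !mxE mulrC.
split=> [[x [x01 ->]]|[x x01 ->]].
  exists (\col_i x i) => [i|]; first by rewrite mxE.
  by rewrite -E; apply: eq_bigr => i _; rewrite mxE.
by exists (fun i => x i 0); split => //; rewrite E.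
Qed.

Lemma zonotope_compl s : zonotope Ht s -> zonotope Ht (Ht *m ones - s).
Proof.
move=> /zonotopeP[x x01 ->]; apply/zonotopeP.
exists (ones - x) => [i|]; last by rewrite mulmxBr.
by have /andP[x0 x1] := x01 i; rewrite !mxE subr_ge0 x1 lerBlDr lerDl.
Qed.

Lemma lift_at01 s t : zonotope Ht s -> fmin V sv s <= t ->
  fmin V sv (Ht *m ones - s) <= (v^T *m ones) 0 0 - t ->
  forall i, 0 <= lift_at s t i 0 <= 1.
Proof.
move=> /zonotopeP[x x01 sE] st1 st2 i.
have [l1 l2] := fmin_le_lift i st1; have := fmin_le_lift i st2.
have -> : lift_at (Ht *m ones - s) ((v^T *m ones) 0 0 - t) i 0 = 1 - lift_at s t i 0.
  by rewrite lift_at_compl; move: (lift_at s t) => y; rewrite !mxE.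
rewrite subr_ge0 lerBlDr lerDl => -[u1 u2].
have [vi|vi|vi] := ltrgtP (v i 0) 0.
- by rewrite l2// u2.
- by rewrite l1// u1.
(* Where [v] vanishes the coordinate is constant along the fibre, so it is that of the cube point
   [x] above [s]. *)
suff -> : lift_at s t i 0 = x i 0 by exact: x01.
by rewrite -[in RHS](lift_reduced_channel x) -sE !lift_atE vi !mulr0.
Qed.

(** For any cube point [x] above [s], the value of [v^T *m x] separates the two sides. *)
Lemma zonotope_fmin_le s : zonotope Ht s ->
  fmin V sv s <= (v^T *m ones) 0 0 - fmin V sv (Ht *m ones - s).
Proof.
move=> /zonotopeP[x x01 ->]; rewrite lerBrDr -lerBrDl -mulmxBr.
apply: (le_trans (fmin_le_last _)) => [i|].
  by have /andP[x0 x1] := x01 i; rewrite !mxE subr_ge0 x1 lerBlDr lerDl.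
have -> : (v^T *m (ones - x)) 0 0 = (v^T *m ones) 0 0 - (v^T *m x) 0 0.
  by rewrite mulmxBr; move: (v^T *m ones) (v^T *m x) => y z; rewrite !mxE.
by rewrite lerD2l lerN2; exact: fmin_le_last.
Qed.

(** The minimum is attained: [fmin V sv s] is the last coordinate of the cube point
    [lift_at s (fmin V sv s)]. *)
Lemma fmin_bounded s : zonotope Ht s -> `|fmin V sv s| <= \sum_i `|v i 0|.
Proof.
move=> Zs.
have bnd (x : 'cV[R]_r.+1) : (forall i, 0 <= x i 0 <= 1) ->
    `|(v^T *m x) 0 0| <= \sum_i `|v i 0|.
  move=> x01; rewrite mxE; apply: le_trans (ler_norm_sum _ _ _) _.
  apply: ler_sum => i _; rewrite mxE normrM ler_piMr//.
  by have /andP[x0 x1] := x01 i; rewrite ger0_norm.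
rewrite -[X in `|X|](last_lift s); apply: bnd; apply: lift_at01 => //.
by rewrite lerBrDr -lerBrDl; exact: zonotope_fmin_le.
Qed.

End optical_channel.

(** * Topology against the coordinate sigma-algebra, and supports *)

Section cV_topology.
Context (R : realType) (n : nat).

Lemma measurable_cV_box (A : 'I_n -> set R) : (forall i, measurable (A i)) ->
  measurable [set x : 'cV[R]_n | forall i, A i (x i 0)].
Proof.
move=> mA; rewrite (_ : [set x | _] =
    \bigcap_(i in [set: 'I_n]) ((fun x : 'cV[R]_n => x i 0) @^-1` A i)).
  apply: fin_bigcap_measurable; first exact: finite_finset.
  by move=> i _; rewrite -[X in measurable X]setTI; exact: measurable_coord.
by apply/seteqP; split => [x /= h i _|x /= h i]; apply: h.
Qed.

(** A countable base of the topology made of measurable sets. *)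
Definition rat_box (p : {ffun 'I_n -> rat * rat}) : set 'cV[R]_n :=
  [set x | forall i, x i 0 \in `]ratr (p i).1, ratr (p i).2[].

Lemma measurable_rat_box p : measurable (rat_box p).
Proof.
exact: (measurable_cV_box (A := fun i => [set` `]ratr (p i).1, ratr (p i).2[])).
Qed.

Lemma open_rat_box (U : set 'cV[R]_n) x : open U -> U x ->
  exists p, rat_box p x /\ rat_box p `<=` U.
Proof.
move=> oU Ux; have : nbhs x U by exact: open_nbhs_nbhs.
move=> /nbhs_ballP[e /= e0 xeU].
have ratP i : exists q : rat * rat,
    x i 0 - e < ratr q.1 < x i 0 /\ x i 0 < ratr q.2 < x i 0 + e.
  have [|a xa] := @rat_in_itvoo R (x i 0 - e) (x i 0); first by rewrite ltrBlDr ltrDl.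
  have [|b xb] := @rat_in_itvoo R (x i 0) (x i 0 + e); first by rewrite ltrDl.
  by exists (a, b); move: xa xb; rewrite !in_itv.
have [q qP] := choice ratP.
exists [ffun i => q i]; split=> [i|y xy].
  by have [/andP[_ xq] /andP[qx _]] := qP i; rewrite in_itv/= ffunE xq qx.
apply: xeU; split => // i j; rewrite ord1 /ball/= ltr_distlC.
have := xy i; rewrite in_itv/= ffunE => /andP[ay yb].
have [/andP[xa _] /andP[_ bx]] := qP i.
by rewrite (lt_trans xa ay) (lt_trans yb bx).
Qed.

Lemma open_measurable_cV (U : set 'cV[R]_n) : open U -> measurable U.
Proof.
move=> oU; rewrite (_ : U =
    \bigcup_p (if `[< rat_box p `<=` U >] then rat_box p else set0)).
  apply: countable_bigcupT_measurable; first exact: countableP.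
  by move=> p; case: ifP => _; [exact: measurable_rat_box|exact: measurable0].
apply/seteqP; split=> [x Ux|x [p _]].
  have [p [xp pU]] := open_rat_box oU Ux.
  by exists p => //; rewrite asboolT.
by case: ifPn => // /asboolP pU; exact: pU.
Qed.

Lemma closed_law_support_sub (P : probability 'cV[R]_n R) (F : set 'cV[R]_n) :
  closed F -> P (~` F) = 0%E -> law_support P `<=` F.
Proof.
move=> cF PF0 x Px; apply: contrapT => nFx.
by have := Px _ (closed_openC cF) nFx; rewrite PF0 ltxx.
Qed.

(** Every point outside the support lies in a null rational box, and there are countably many of
    these. *)
Lemma ae_law_support (P : probability 'cV[R]_n R) :
  {ae P, forall x, law_support P x}.
Proof.
pose B k := if unpickle k is Some p then
  if `[< P (rat_box p) = 0%E >] then rat_box p else set0 else set0.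
apply: (@negligibleS _ _ _ _ (\bigcup_k B k)); last first.
  apply: negligible_bigcup => k; rewrite /B; case: unpickle => [p|]; last first.
    exact: negligible_set0.
  case: ifPn => [/asboolP p0|_]; last exact: negligible_set0.
  by exists (rat_box p); split => //; exact: measurable_rat_box.
move=> x /= /existsNP[U /not_implyP[oU /not_implyP[Ux /negP]]].
rewrite -leNgt => PU0; have [p [xp pU]] := open_rat_box oU Ux.
exists (pickle p) => //; rewrite /B pickleK asboolT//.
apply/eqP; rewrite -measure_le0; apply: le_trans PU0.
by rewrite le_measure// inE; [exact: measurable_rat_box|exact: open_measurable_cV].
Qed.

End cV_topology.

Lemma mx_continuous (T : topologicalType) (K : numFieldType) (m n : nat)
    (f : T -> 'M[K]_(m, n)) :
  (forall i j, continuous (fun x => f x i j)) -> continuous f.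
Proof.
move=> cf x A [E Ef EA].
have : \forall y \near x, forall ij : 'I_m * 'I_n, E ij.1 ij.2 (f y ij.1 ij.2).
  by apply: filter_forall => -[i j]; exact: cf (Ef i j).
by apply: filterS => y Ey; apply: EA => i j; exact: (Ey (i, j)).
Qed.

(** It is the continuous image of a compact cube. *)
Lemma zonotope_closed (R : realType) (m n : nat) (A : 'M[R]_(m, n)) :
  closed (zonotope A).
Proof.
pose f (y : 'rV[R]_n) : 'cV[R]_m := \sum_i y 0 i *: col i A.
rewrite (_ : zonotope A =
    f @` [set y : 'rV[R]_n | forall i, `[0, 1]%classic (y 0 i)]).
  apply: compact_closed; first exact: norm_hausdorff.
  apply: continuous_compact; last first.
    have := @rV_compact R n (fun=> `[0, 1]%classic) (fun=> @segment_compact R 0 1).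
    exact.
  apply: continuous_subspaceT; apply: mx_continuous => i j.
  rewrite (_ : (fun y => _) = (fun y : 'rV[R]_n => \sum_k y 0 k * A i k)); last first.
    apply/funext => y; rewrite /f summxE; apply: eq_bigr => k _.
    by rewrite !mxE.
  apply: continuous_big => [|k _]; first exact: add_continuous.
  move=> y; apply: (@continuousM _ _ (fun y : 'rV[R]_n => y 0 k) (cst (A i k))).
    exact: coord_continuous.
  exact: cst_continuous.
apply/seteqP; split=> [_ [x [x01 ->]]|_ [y y01 <-]].
  exists (\row_i x i) => [i|]; first by rewrite /= mxE in_itv/=.
  by apply: eq_bigr => i _; rewrite mxE.
by exists (fun i => y 0 i); split => // i; have := y01 i; rewrite /= in_itv.
Qed.

(** * Integrals under almost sure bounds, and means of affine images *)

Section integral_ae.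
Local Open Scope ereal_scope.
Context d (T : measurableType d) (R : realType).

Lemma ae_le_integral (mu : {measure set T -> \bar R}) (f g : T -> \bar R) :
  measurable_fun setT f -> measurable_fun setT g ->
  {ae mu, forall x, f x <= g x} -> \int[mu]_x f x <= \int[mu]_x g x.
Proof.
move=> mf mg fg; rewrite integralE [leRHS]integralE; apply: leeB.
- apply: ae_ge0_le_integral => //; [exact: measurable_funepos..|].
  apply: filterS fg => x fgx _.
  by rewrite !funeposE ge_max !le_max fgx lexx orbT.
- apply: ae_ge0_le_integral => //; [exact: measurable_funeneg..|].
  apply: filterS fg => x fgx _.
  by rewrite !funenegE ge_max !le_max leeN2 fgx lexx orbT.
Qed.

(** A difference in [\bar R] is finite only if both terms are; hence [has_mean] alone makes the
    coordinates integrable. *)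
Lemma fin_num_integrable (mu : {measure set T -> \bar R}) (f : T -> \bar R) :
  measurable_fun setT f -> \int[mu]_x f x \is a fin_num -> mu.-integrable setT f.
Proof.
move=> mf; rewrite integralE fin_numB => /andP[fp fn].
apply/integrableP; split => //.
under eq_integral do rewrite -[`|_|]/((abse \o f) _) fune_abse.
rewrite ge0_integralD//; [|exact: measurable_funepos|exact: measurable_funeneg].
by apply: lte_add_pinfty; rewrite -ge0_fin_numE// integral_ge0.
Qed.

Lemma ae_bounded_integrable (P : probability T R) (f : T -> R) (M : R) :
  measurable_fun setT f -> {ae P, forall x, (`|f x| <= M)%R} ->
  P.-integrable setT (EFin \o f).
Proof.
move=> mf fM; have mEf : measurable_fun setT (EFin \o f) by exact/measurable_EFinP.
apply/integrableP; split => //.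
apply: (@le_lt_trans _ _ (\int[P]_x (cst M%:E) x)).
  apply: ae_le_integral; [exact: measurableT_comp|exact: measurable_cst|].
  by apply: filterS fM => x; rewrite /= lee_fin.
by rewrite integral_cst//= probability_setT mule1 ltry.
Qed.

End integral_ae.

Lemma ae_distributionP d d' (T : measurableType d) (T' : measurableType d')
    (R : realType) (P : probability T R) (phi : {mfun T >-> T'}) (p : set T') :
  measurable p -> {ae P, forall x, p (phi x)} ->
  {ae distribution P phi, forall y, p y}.
Proof.
move=> mp pphi; exists (~` p); split => //; first exact: measurableC.
apply: (@measure_negligible _ _ _ P (phi @^-1` (~` p))) => //.
rewrite -[X in measurable X]setTI; apply: measurable_funP => //.
exact: measurableC.
Qed.

Section affine_mean.
Local Open Scope ereal_scope.
Context (R : realType) (n : nat) (P : probability 'cV[R]_n R) (mu : 'cV[R]_n).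
Hypothesis P_mean : has_mean P mu.

Lemma has_mean_integrable k : P.-integrable setT (fun x : 'cV[R]_n => (x k 0)%:E).
Proof.
apply: fin_num_integrable; first by apply/measurable_EFinP; exact: measurable_coord.
by have := P_mean k; rewrite unlock => ->.
Qed.

Lemma integrable_affine (c : R) (w : 'I_n -> R) :
  P.-integrable setT (fun x => (c + \sum_j w j * x j 0)%:E).
Proof.
under eq_fun do rewrite EFinD -sumEFin.
apply: integrableD => //; first exact: finite_measure_integrable_cst.
apply: integrable_sum => // j _.
under eq_fun do rewrite EFinM.
by apply: (integrableZl measurableT); exact: has_mean_integrable.
Qed.

Lemma integral_affine (c : R) (w : 'I_n -> R) :
  \int[P]_x (c + \sum_j w j * x j 0)%:E = (c + \sum_j w j * mu j 0)%:E.
Proof.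
have intw j : P.-integrable setT (fun x : 'cV[R]_n => (w j * x j 0)%:E).
  under eq_fun do rewrite EFinM.
  by apply: (integrableZl measurableT); exact: has_mean_integrable.
under eq_integral do rewrite EFinD -sumEFin.
rewrite integralD//; [|exact: finite_measure_integrable_cst|exact: integrable_sum].
rewrite integral_cst//= probability_setT mule1 integral_sum// EFinD -sumEFin.
congr (_ + _); apply: eq_bigr => j _.
under eq_integral do rewrite EFinM.
rewrite integralZl//; last exact: has_mean_integrable.
by have := P_mean j; rewrite unlock => ->.
Qed.

End affine_mean.

Lemma integral_combination d (T : measurableType d) (R : realType)
    (mu : {measure set T -> \bar R}) (f g : T -> R) (a b F G : R) :
  mu.-integrable setT (EFin \o f) -> mu.-integrable setT (EFin \o g) ->
  (\int[mu]_x (f x)%:E = F%:E)%E -> (\int[mu]_x (g x)%:E = G%:E)%E ->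
  mu.-integrable setT (EFin \o (fun x => a * f x + b * g x)) /\
  (\int[mu]_x (a * f x + b * g x)%:E = (a * F + b * G)%:E)%E.
Proof.
move=> fi gi fF gG.
have afi : mu.-integrable setT (fun x => (a * f x)%:E).
  by under eq_fun do rewrite EFinM; exact: (integrableZl measurableT).
have bgi : mu.-integrable setT (fun x => (b * g x)%:E).
  by under eq_fun do rewrite EFinM; exact: (integrableZl measurableT).
split; first exact: (integrableD measurableT afi bgi).
under eq_integral do rewrite EFinD.
rewrite integralD//.
under eq_integral do rewrite EFinM.
under [X in (_ + X)%E]eq_integral do rewrite EFinM.
by rewrite !integralZl// fF gG.
Qed.

Lemma integral_mulmx (R : realType) (m n : nat) (P : probability 'cV[R]_n R)
    (mu : 'cV[R]_n) (A : 'M[R]_(m, n)) i :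
  has_mean P mu ->
  P.-integrable setT (fun x => ((A *m x) i 0)%:E) /\
  (\int[P]_x ((A *m x) i 0)%:E = ((A *m mu) i 0)%:E)%E.
Proof.
move=> Pmu.
have E (x : 'cV[R]_n) : (A *m x) i 0 = 0 + \sum_j A i j * x j 0.
  by rewrite add0r mxE.
split; first by under eq_fun do rewrite E; exact: (integrable_affine Pmu).
by rewrite E; under eq_integral do rewrite E; exact: integral_affine.
Qed.

Lemma measurable_fmin (R : realType) (r : nat) (V : 'M[R]_r.+1) (sv : 'rV[R]_r) :
  measurable_fun setT (fmin V sv).
Proof.
rewrite /fmin; apply: measurableT_comp => //.
elim: (index_enum _) => [|i l ih].
  by under eq_fun do rewrite big_nil; exact: measurable_cst.
have [vi|/negbTE vi] := boolP (last_column V i 0 != 0); last first.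
  by under eq_fun do rewrite big_cons vi.
under eq_fun do rewrite big_cons vi.
apply: measurable_maxe => //; apply/measurable_EFinP.
apply: measurable_funB => //; apply: measurable_sum => j.
apply: measurable_funM => //; apply: measurable_funM => //.
exact: measurable_coord.
Qed.

(** * Correspondence between input laws and laws on the zonotope *)

Section reduced_laws.
Context (R : realType) (r : nat).
Variables (V : 'M[R]_r.+1) (sv : 'rV[R]_r) (alpha : 'cV[R]_r.+1).
Hypotheses (sv_gt0 : forall i, 0 < sv 0 i) (V_orth : V^T *m V = 1%:M).

Local Notation v := (last_column V).
Local Notation Ht := (reduced_channel V sv).
Local Notation ones := (const_mx 1 : 'cV[R]_r.+1).
Local Notation upper := ((v^T *m ones) 0 0).

Let mfmin_compl :
  measurable_fun setT (fun s : 'cV[R]_r => fmin V sv (Ht *m ones - s)).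
Proof.
apply: (measurableT_comp (measurable_fmin V sv)).
apply/measurable_fun_coordP => i.
rewrite (_ : (fun s => _) = (fun s : 'cV[R]_r => (Ht *m ones) i 0 - s i 0)).
  by apply: measurable_funB => //; exact: measurable_coord.
by apply/funext => s; rewrite !mxE.
Qed.

Let mean_compl (P : probability 'cV[R]_r.+1 R) : has_mean P alpha ->
  (\int[P]_x ((v^T *m (ones - x)) 0 0)%:E = ((v^T *m (ones - alpha)) 0 0)%:E)%E.
Proof.
move=> Palpha.
have E (x : 'cV[R]_r.+1) :
    (v^T *m (ones - x)) 0 0 = upper + \sum_j - v j 0 * x j 0.
  rewrite mulmxBr; move: (v^T *m ones) => u; rewrite !mxE -sumrN; congr (_ + _).
  by apply: eq_bigr => j _; rewrite !mxE mulNr.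
rewrite E; under eq_integral do rewrite E.
exact: integral_affine.
Qed.

(** Integrate [fmin_le_last] at [x] for the first moment bound and at [ones - x], again a cube
    point, for the second. *)
Lemma reduced_law_feasible (P : probability 'cV[R]_r.+1 R) : equal_cost alpha P ->
  let P' := distribution P (linear_map Ht) in
  [/\ law_support P' `<=` zonotope Ht, has_mean P' (Ht *m alpha),
      ('E_P'[fmin V sv] <= ((v^T *m alpha) 0 0)%:E)%E &
      ('E_P'[fun s => fmin V sv (Ht *m ones - s)] <=
        ((v^T *m (ones - alpha)) 0 0)%:E)%E].
Proof.
move=> [box Palpha] P'; have [intv Ev] := integral_mulmx v^T 0 Palpha.
have mv : measurable_fun setT (fun x : 'cV[R]_r.+1 => ((v^T *m x) 0 0)%:E).
  exact: measurable_int intv.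
split.
- apply: closed_law_support_sub; first exact: zonotope_closed.
  apply: (@measure_negligible _ _ _ P (linear_map Ht @^-1` (~` zonotope Ht))) => //.
    rewrite -[X in measurable X]setTI; apply: measurable_funP => //.
    by apply: open_measurable_cV; apply: closed_openC; exact: zonotope_closed.
  apply: filterS box => x x01 /=.
  by apply/zonotopeP; exists x.
- move=> k; rewrite unlock integral_distributionT /=; last first.
    by apply/measurable_EFinP; exact: measurable_coord.
  exact: (integral_mulmx Ht k Palpha).2.
- rewrite unlock integral_distributionT /=; last first.
    by apply/measurable_EFinP; exact: measurable_fmin.
  rewrite -Ev; apply: ae_le_integral => //.
    apply/measurable_EFinP; apply: (measurableT_comp (measurable_fmin V sv)).
    exact: measurable_funP.
  by apply: filterS box => x x01; rewrite lee_fin; exact: fmin_le_last.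
- rewrite unlock integral_distributionT /=; last first.
    by apply/measurable_EFinP; exact: mfmin_compl.
  rewrite -(mean_compl Palpha); apply: ae_le_integral.
  + apply/measurable_EFinP; apply: (measurableT_comp mfmin_compl).
    exact: measurable_funP.
  + apply/measurable_EFinP.
    rewrite (_ : (fun x => _) =
        (fun x : 'cV[R]_r.+1 => upper - (v^T *m x) 0 0)); last first.
      by apply/funext => x; rewrite mulmxBr; move: (v^T *m _) (v^T *m _) => y z;
        rewrite !mxE.
    by apply: measurable_funB => //; apply/measurable_EFinP.
  + apply: filterS box => x x01; rewrite lee_fin /linear_map -mulmxBr.
    apply: fmin_le_last => // i.
    by have /andP[x0 x1] := x01 i; rewrite !mxE subr_ge0 x1 lerBlDr lerDl.
Qed.

(* The two moment constraints say E fmin <= v^T alpha <= E fmax, hence the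
   choice of lambda. *)
Lemma feasible_law_lift (P : probability 'cV[R]_r R) :
  law_support P `<=` zonotope Ht -> has_mean P (Ht *m alpha) ->
  ('E_P[fmin V sv] <= ((v^T *m alpha) 0 0)%:E)%E ->
  ('E_P[fun s => fmin V sv (Ht *m ones - s)] <=
     ((v^T *m (ones - alpha)) 0 0)%:E)%E ->
  exists2 Q : probability 'cV[R]_r.+1 R, equal_cost alpha Q &
    forall C, measurable C -> P C = Q (linear_map Ht @^-1` C).
Proof.
move=> supp Pmean; rewrite !unlock.
set c := (v^T *m alpha) 0 0; set c' := (v^T *m (ones - alpha)) 0 0.
have c'E : c' = upper - c.
  by rewrite /c' /c mulmxBr; move: (v^T *m _) (v^T *m _) => y z; rewrite !mxE.
have aeZ : {ae P, forall s, zonotope Ht s}.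
  by apply: filterS (ae_law_support P) => s; exact: supp.
pose n s := fmin V sv (Ht *m ones - s).
have mi : P.-integrable setT (EFin \o fmin V sv).
  apply: ae_bounded_integrable (measurable_fmin V sv) _.
  by apply: filterS aeZ => s; exact: fmin_bounded.
have ni : P.-integrable setT (EFin \o n).
  apply: ae_bounded_integrable mfmin_compl _.
  apply: filterS aeZ => s Zs.
  by apply: fmin_bounded => //; exact: zonotope_compl.
have [m0 mE] : exists m0, (\int[P]_s (fmin V sv s)%:E = m0%:E)%E.
  by exists (fine (\int[P]_s (fmin V sv s)%:E)%E); rewrite fineK//;
    exact: (integrable_fin_num _ mi).
have [n0 nE] : exists n0, (\int[P]_s (n s)%:E = n0%:E)%E.
  by exists (fine (\int[P]_s (n s)%:E)%E); rewrite fineK//;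
    exact: (integrable_fin_num _ ni).
rewrite mE nE !lee_fin c'E lerBrDr -lerBrDl => m0c cn0.
have [lam /andP[lam0 lam1] lamE] : exists2 lam : R, 0 <= lam <= 1 &
    lam * m0 + (1 - lam) * (upper - n0) = c.
  (* With [m0 <= c <= upper - n0], either the interval is a single point and any weight works, or
     the weight solves the affine equation. *)
  have [mn|mn] := ltrP m0 (upper - n0); last first.
    exists 1; rewrite ?ler01 ?lexx//; lra.
  have d0 : 0 < upper - n0 - m0 by rewrite subr_gt0.
  exists ((upper - n0 - c) / (upper - n0 - m0)).
    rewrite divr_ge0 ?(ltW d0)//=; last lra.
    by rewrite ler_pdivrMr// mul1r lerD2l lerN2.
  by field; rewrite gt_eqF.
(* Written as a linear combination to match [integral_combination]. *)
pose fmax s := upper * 1 + -1 * n s.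
have [fmaxi fmaxE] : P.-integrable setT (EFin \o fmax) /\
    (\int[P]_s (fmax s)%:E = (upper * 1 + -1 * n0)%:E)%E.
  apply: (@integral_combination _ _ _ P (fun=> 1) n) => //.
    exact: finite_measure_integrable_cst.
  by rewrite integral_cst//= probability_setT mule1.
pose T s := lam * fmin V sv s + (1 - lam) * fmax s.
have [Ti TE] := integral_combination lam (1 - lam) mi fmaxi mE fmaxE.
rewrite -/T mulr1 mulN1r lamE in Ti TE.
pose G s := lift_at V sv s (T s).
have mT : measurable_fun setT T.
  by apply/measurable_EFinP; exact: measurable_int Ti.
have mG : measurable_fun setT G.
  apply/measurable_fun_coordP => i; rewrite /G.
  under eq_fun do rewrite lift_atE.
  apply: measurable_funD; last exact: measurable_funM.
  apply/measurable_EFinP.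
  exact: measurable_int (integral_mulmx (lift_matrix V sv) i Pmean).1.
pose Gmix := isMeasurableFun.Build _ _ _ _ G mG.
pose Gpack : {mfun 'cV[R]_r >-> 'cV[R]_r.+1} := HB.pack G Gmix.
exists (distribution P Gpack); last first.
  move=> C mC; congr (P _); apply/seteqP.
  by split => s /=; rewrite /G /linear_map reduced_channel_lift.
split.
  apply: (@ae_distributionP _ _ _ _ _ _ Gpack
    [set x : 'cV[R]_r.+1 | forall k, 0 <= x k 0 <= 1]).
    rewrite (_ : [set x | _] =
        [set x : 'cV[R]_r.+1 | forall k, `[0, 1]%classic (x k 0)]); last first.
      by apply/seteqP; split => x /= x01 k; have := x01 k; rewrite in_itv.
    apply: (measurable_cV_box (A := fun=> `[0, 1]%classic)) => k.
    exact: measurable_itv.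
  (* Over the zonotope [T s] is a convex combination of the ends of the fibre segment, so the lifted
     point stays in the cube. *)
  apply: filterS aeZ => s Zs; have mM := zonotope_fmin_le sv_gt0 V_orth Zs.
  have fE : fmax s = upper - n s by rewrite /fmax; ring.
  have mM' : 0 <= fmax s - fmin V sv s by rewrite fE subr_ge0.
  apply: lift_at01 => //.
    rewrite /T; nra.
  have -> : fmin V sv (Ht *m ones - s) = upper - fmax s by rewrite fE /n; ring.
  rewrite /T; nra.
move=> k; rewrite unlock integral_distributionT /=; last first.
  by apply/measurable_EFinP; exact: measurable_coord.
have [Wi WE] := integral_mulmx (lift_matrix V sv) k Pmean.
have [_] := integral_combination 1 (v k 0) Wi Ti WE TE.
under eq_integral do rewrite mul1r [v k 0 * _]mulrC -lift_atE.
move=> ->; rewrite mul1r mulrC -lift_atE.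
(* By linearity the mean of the lift is the lift of the means [Ht *m alpha] and [c], which is
   [alpha]. *)
by rewrite /c lift_reduced_channel.
Qed.

End reduced_laws.

Theorem theorem3 (R : realType) (nR r : nat) (H : 'M[R]_(nR, r.+1))
    (sv : 'rV[R]_r) (V : 'M[R]_r.+1) (alpha : 'cV[R]_r.+1) (sigma : R)
    (r_ge1 : (1 <= r)%N)
    (H_ge0 : forall i j, 0 <= H i j)
    (rank_H : \rank H = r)
    (sv_H : nonzero_singular_values H sv)
    (V_orth : V^T *m V = 1%:M)
    (V_eigen : forall i : 'I_r,
       (H^T *m H) *m col i (first_columns V) =
         (sv 0 i ^+ 2) *: col i (first_columns V))
    (alpha01 : forall k, 0 <= alpha k 0 <= 1)
    (sigma_gt0 : 0 < sigma) :
  let Ht := reduced_channel V sv in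
  let ones : 'cV[R]_r.+1 := const_mx 1 in
  equal_cost_capacity Ht alpha sigma =
  ereal_sup [set channel_information (@identity_map R r) sigma P |
    P in [set P : probability 'cV[R]_r R |
      [/\ law_support P `<=` zonotope Ht,
          has_mean P (Ht *m alpha),
          ('E_P[fmin V sv] <= (((last_column V)^T *m alpha) 0%R 0%R)%:E)%E &
          ('E_P[fun s => fmin V sv (Ht *m ones - s)%R] <=
             (((last_column V)^T *m (ones - alpha)%R) 0%R 0%R)%:E)%E]]].
Proof.
move=> Ht ones; have [sv_gt0 _ _] := sv_H.
(* The two sets of attainable information values coincide, not only their suprema. *)
congr ereal_sup; apply/seteqP; split=> y [P].
  move=> Pcost <-; exists (distribution P (linear_map Ht)).
    exact: reduced_law_feasible.
  exact/esym/channel_information_pushforward.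
move=> [supp Pmean Emin Emax] <-.
have [Q Qcost PQ] := feasible_law_lift sv_gt0 V_orth supp Pmean Emin Emax.
by exists Q => //; exact: channel_information_pushforward.
Qed.
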